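(* The action of $T_3$ on the $4$-dimensional space $\mathcal P_{8,2}$ has an invariant (singular) symplectic form and two algebraically independent rational invariants which Poisson commute with respect to it. That is, in the coordinates $(a,b,c,d)$ there exist a closed $2$-form $\omega$ with rational coefficients, defined and nondegenerate on an open dense subset of $\mathbb R^4$, and algebraically independent rational functions $F_1,F_2$ of $(a,b,c,d)$, such that $T_3^*\omega=\omega$, $F_1\circ T_3=F_1$ and $F_2\circ T_3=F_2$, and $\omega(X_1,X_2)=0$, where $X_j$ is the Hamiltonian vector field of $F_j$ with respect to $\omega$ (all identities holding where the objects are defined).
   Context: $\mathcal P_{8,2}$ is the space of affine equivalence classes of (labelled) centrally symmetric octagons, i.e. octagons with $v_{k+4}=-v_k$. Each (generic) class has a canonical representative with vertices $v_0,\dots,v_7$ equal to $$(1,0),\ (a,b),\ (0,1),\ (-d,c),\ (-1,0),\ (-a,-b),\ (0,-1),\ (d,-c),$$ and $(a,b,c,d)$ are its coordinates, which identify $\mathcal P_{8,2}$ with an open dense subset of $\mathbb R^4$. The $3$-diagonal map $T_3$ sends the octagon with vertices $v_k$ to the octagon with vertices $v_k'=\overline{v_{k+1}v_{k+4}}\cap\overline{v_{k+2}v_{k+5}}$ (indices mod $8$), which is then normalized by an affine transformation to the canonical form above to read off its coordinates. In coordinates, with $e=ac+bd$, one has $T_3=A\Delta A\Delta$ (composition), where $A(a,b,c,d)=(-b,-a,-d,-c)$ and $$\Delta(a,b,c,d)=\left(\frac{b(c+d+1)}{c(e+a+c+1)},\frac{d(e+b+c)}{c(e+a+c+1)},\frac{d(a+b+1)}{a(e+a+c+1)},\frac{b(e+a+d)}{a(e+a+c+1)}\right).$$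 The Hamiltonian vector field $X_j$ of $F_j$ is the vector field with $\omega(X_j,V)=D_VF_j$ for all vectors $V$. *)

(* Defs.v *)
From HB Require Import structures.
From mathcomp Require Import all_boot all_order all_algebra.
From mathcomp Require Import all_classical all_reals all_analysis.
From mathcomp Require Import ring.
(* The notations of [mpoly] clash with those of MathComp-Analysis. *)
From mathcomp Require Import -(notations) mpoly.

Set Implicit Arguments.
Unset Strict Implicit.
Unset Printing Implicit Defensive.

Import Order.TTheory GRing.Theory Num.Theory.
Import numFieldNormedType.Exports.

Local Open Scope classical_set_scope.
Local Open Scope ring_scope.

(* Planar points are row vectors; the index type ['Z_8] makes the vertex
   labels of an octagon cyclic. *)
Definition octagon (R : realType) := 'Z_8 -> 'rV[R]_2.

Definition pt (R : realType) (x y : R) : 'rV[R]_2 := \row_j [:: x; y]`_j.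

Definition cross (R : realType) (u v : 'rV[R]_2) : R :=
  u 0 0 * v 0 1 - u 0 1 * v 0 0.

Definition line (R : realType) (p q : 'rV[R]_2) : set 'rV[R]_2 :=
  [set z | exists t : R, z = p + t *: (q - p)].

(* Nonzero exactly when the lines [pq] and [rs] are genuine and not parallel. *)
Definition lines_cross (R : realType) (p q r s : 'rV[R]_2) : R :=
  cross (q - p) (s - r).

(* Cramer's rule; see [line_meetP]. *)
Definition line_meet (R : realType) (p q r s : 'rV[R]_2) : 'rV[R]_2 :=
  p + (cross (r - p) (s - r) / lines_cross p q r s) *: (q - p).

Definition centrally_symmetric (R : realType) (v : octagon R) :=
  forall k : 'Z_8, v (k + 4) = - v k.

Definition affine_equiv (R : realType) (v w : octagon R) :=
  exists (M : 'M[R]_2) (t : 'rV[R]_2),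
    M \in unitmx /\ forall k, w k = v k *m M + t.

(* The representative with coordinates [x = (a, b, c, d)]. *)
Definition canonical (R : realType) (x : 'rV[R]_4) : octagon R :=
  let a := x 0 0 in let b := x 0 1 in let c := x 0 2 in let d := x 0 3 in
  fun k => nth 0 [:: pt 1 0;    pt a b;         pt 0 1;    pt (- d) c;
                     pt (-1) 0; pt (- a) (- b); pt 0 (-1); pt d (- c)] k.

(* The coordinates of a centrally symmetric octagon: [w 1 = a w_0 + b w_2] and
   [w 3 = - d w_0 + c w_2], solved by Cramer's rule; see [coordsP]. *)
Definition coords (R : realType) (w : octagon R) : 'rV[R]_4 :=
  \row_j [:: cross (w 1) (w 2) / cross (w 0) (w 2);
             cross (w 0) (w 1) / cross (w 0) (w 2);
             cross (w 0) (w 3) / cross (w 0) (w 2);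
             cross (w 2) (w 3) / cross (w 0) (w 2)]`_j.

Definition diag3 (R : realType) (v : octagon R) : octagon R :=
  fun k => line_meet (v (k + 1)) (v (k + 4)) (v (k + 2)) (v (k + 5)).

Definition T3 (R : realType) (x : 'rV[R]_4) : 'rV[R]_4 :=
  coords (diag3 (canonical x)).

Definition T3_defined (R : realType) (x : 'rV[R]_4) :=
  let v := canonical x in
  (forall k : 'Z_8,
     lines_cross (v (k + 1)) (v (k + 4)) (v (k + 2)) (v (k + 5)) != 0)
  /\ cross (diag3 v 0) (diag3 v 2) != 0.

(* A rational function in [n] variables, given as a fraction of polynomials.
   [ratval] has the junk value 0 where the denominator vanishes; the domain
   [rdefined] is that of the given fraction, which need not be reduced. *)
Record ratfun (R : realType) (n : nat) := RatFun {
  rnum : mpoly n R;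
  rden : mpoly n R;
  rden_neq0 : rden != 0 }.

Definition pval (R : realType) (n : nat) (p : mpoly n R)
  (x : 'rV[R]_n) : R := meval (fun i => x 0 i) p.

Definition rdefined (R : realType) (n : nat) (F : ratfun R n) (x : 'rV[R]_n) :=
  pval (rden F) x != 0.

Definition ratval (R : realType) (n : nat) (F : ratfun R n)
  (x : 'rV[R]_n) : R := pval (rnum F) x / pval (rden F) x.

(* Vanishing of [P(F1, F2)] in the field of rational functions is vanishing on
   the common domain, which is dense. *)
Definition alg_independent2 (R : realType) (n : nat) (F1 F2 : ratfun R n) :=
  forall P : mpoly 2 R,
    (forall x, rdefined F1 x -> rdefined F2 x ->
       pval P (pt (ratval F1 x) (ratval F2 x)) = 0) ->
    P = 0.

(* The 2-form [\sum_(i < j) W i j dx_i /\ dx_j]; only the entries with [i < j]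
   are used. *)
Definition form2 (R : realType) (n : nat) := 'I_n -> 'I_n -> ratfun R n.

Definition fdefined (R : realType) (n : nat) (W : form2 R n) (x : 'rV[R]_n) :=
  forall i j : 'I_n, (i < j)%N -> rdefined (W i j) x.

Definition fval (R : realType) (n : nat) (W : form2 R n)
  (x u v : 'rV[R]_n) : R :=
  \sum_(i < n) \sum_(j < n | (i < j)%N)
    ratval (W i j) x * (u 0 i * v 0 j - u 0 j * v 0 i).

(* The exterior derivative, evaluated on constant vector fields. *)
Definition ext_deriv (R : realType) (n : nat) (W : form2 R n.+1)
  (x u v w : 'rV[R]_n.+1) : R :=
  'D_u (fun y => fval W y v w) x - 'D_v (fun y => fval W y u w) x
  + 'D_w (fun y => fval W y u v) x.

Definition form_closed (R : realType) (n : nat) (W : form2 R n.+1) :=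
  forall x, fdefined W x -> forall u v w, ext_deriv W x u v w = 0.

Definition nondegenerate_at (R : realType) (n : nat) (W : form2 R n)
  (x : 'rV[R]_n) :=
  forall u, (forall v, fval W x u v = 0) -> u = 0.

Definition regular_at (R : realType) (n : nat) (W : form2 R n)
  (x : 'rV[R]_n) := fdefined W x /\ nondegenerate_at W x.

Definition singular_symplectic (R : realType) (n : nat) (W : form2 R n.+1) :=
  form_closed W /\
  exists U : set 'rV[R]_n.+1,
    [/\ open U, dense U & forall x, U x -> regular_at W x].

(* [T3] is a rational map, differentiable wherever [T3_defined] holds, so ['d]
   is the genuine differential there. *)
Definition form_invariant (R : realType) (W : form2 R 4) :=
  forall x, T3_defined x -> fdefined W x -> fdefined W (T3 x) ->
  forall u v, fval W (T3 x) ('d (@T3 R) x u) ('d (@T3 R) x v) = fval W x u v.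

Definition fun_invariant (R : realType) (F : ratfun R 4) :=
  forall x, T3_defined x -> rdefined F x -> rdefined F (T3 x) ->
  ratval F (T3 x) = ratval F x.

Definition hamiltonian_field (R : realType) (n : nat) (W : form2 R n.+1)
  (F : ratfun R n.+1) (X : 'rV[R]_n.+1 -> 'rV[R]_n.+1) :=
  forall x, regular_at W x -> rdefined F x ->
  forall V, fval W x (X x) V = 'D_V (ratval F) x.

Definition poisson_commute (R : realType) (n : nat) (W : form2 R n.+1)
  (F1 F2 : ratfun R n.+1) :=
  forall X1 X2, hamiltonian_field W F1 X1 -> hamiltonian_field W F2 X2 ->
  forall x, regular_at W x -> rdefined F1 x -> rdefined F2 x ->
  fval W x (X1 x) (X2 x) = 0.

Lemma rV2P (R : realType) (u v : 'rV[R]_2) :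
  u 0 0 = v 0 0 -> u 0 1 = v 0 1 -> u = v.
Proof.
move=> h0 h1; apply/rowP => -[[|[|//]] i2].
- by rewrite (_ : Ordinal i2 = 0) //; exact: val_inj.
- by rewrite (_ : Ordinal i2 = 1) //; exact: val_inj.
Qed.

Lemma line_meetP (R : realType) (p q r s : 'rV[R]_2) :
  lines_cross p q r s != 0 ->
  line p q `&` line r s = [set line_meet p q r s].
Proof.
rewrite /lines_cross /cross !mxE => h; apply/seteqP; split => z /=.
- move=> [[t zt] [t' zt']].
  have e0 : p 0 0 + t * (q 0 0 - p 0 0) = r 0 0 + t' * (s 0 0 - r 0 0).
    by have := congr1 (fun u : 'rV[R]_2 => u 0 0) (etrans (esym zt) zt'); rewrite !mxE.
  have e1 : p 0 1 + t * (q 0 1 - p 0 1) = r 0 1 + t' * (s 0 1 - r 0 1).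
    by have := congr1 (fun u : 'rV[R]_2 => u 0 1) (etrans (esym zt) zt'); rewrite !mxE.
  rewrite zt /line_meet /lines_cross /cross !mxE; congr (_ + _ *: _).
  apply: (mulIf h); rewrite divfK //.
  have -> : r 0 0 - p 0 0 = t * (q 0 0 - p 0 0) - t' * (s 0 0 - r 0 0).
    by apply: (addrI (p 0 0)); rewrite [RHS]addrA e0; ring.
  have -> : r 0 1 - p 0 1 = t * (q 0 1 - p 0 1) - t' * (s 0 1 - r 0 1).
    by apply: (addrI (p 0 1)); rewrite [RHS]addrA e1; ring.
  ring.
- move=> ->; split; first by eexists.
  exists (cross (r - p) (q - p) / lines_cross p q r s).
  rewrite /line_meet /lines_cross /cross !mxE.
  by apply: rV2P; rewrite !mxE; field.
Qed.

Lemma det2 (R : comNzRingType) (M : 'M[R]_2) :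
  \det M = M 0 0 * M 1 1 - M 0 1 * M 1 0.
Proof.
rewrite (expand_det_row _ 0) !big_ord_recl big_ord0 /cofactor !det_mx11 !mxE /=.
rewrite addr0 expr0 expr1 mul1r mulN1r mulrN.
by congr (M _ _ * M _ _ - M _ _ * M _ _); apply: val_inj.
Qed.

Lemma mulmx2 (R : comNzRingType) (u : 'rV[R]_2) (M : 'M[R]_2) j :
  (u *m M) 0 j = u 0 0 * M 0 j + u 0 1 * M 1 j.
Proof.
rewrite mxE !big_ord_recl big_ord0 addr0.
by congr (u _ _ * M _ _ + u _ _ * M _ _); apply: val_inj.
Qed.

Lemma cross_mulmx (R : realType) (u v : 'rV[R]_2) (M : 'M[R]_2) :
  cross (u *m M) (v *m M) = \det M * cross u v.
Proof. by rewrite det2 /cross !mulmx2; ring. Qed.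

Lemma canonical_sym (R : realType) (x : 'rV[R]_4) :
  centrally_symmetric (canonical x).
Proof.
by move=> [[|[|[|[|[|[|[|[|//]]]]]]]] i]; apply: rV2P; rewrite !mxE /= ?opprK ?oppr0.
Qed.

Lemma coordsP (R : realType) (w : octagon R) (x : 'rV[R]_4) :
  centrally_symmetric w -> cross (w 0) (w 2) != 0 ->
  affine_equiv w (canonical x) <-> x = coords w.
Proof.
move=> sw D0; split.
- move=> [M [t [uM wM]]].
  have t0 : t = 0.
    have := canonical_sym x 0; rewrite !wM sw mulNmx opprD => /addrI/eqP.
    by rewrite -subr_eq0 opprK -mulr2n -scaler_nat scaler_eq0 pnatr_eq0 => /eqP.
  have wE k : canonical x k = w k *m M by rewrite wM t0 addr0.
  have cE k l : cross (w k) (w l) / cross (w 0) (w 2) =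
      cross (canonical x k) (canonical x l) / cross (canonical x 0) (canonical x 2).
    have dM : \det M != 0 by rewrite -unitfE -unitmxE.
    by rewrite !wE !cross_mulmx; field; rewrite D0 dM.
  rewrite /coords !cE /cross !mxE /=.
  apply/rowP => -[[|[|[|[|//]]]] i]; rewrite !mxE /=;
    rewrite !(mulr0, mul0r, mulr1, mul1r, subr0, oppr0, divr1, sub0r, opprK, mulNr, addr0);
    congr (x _ _); exact: val_inj.
- move=> ->.
  pose M : 'M[R]_2 := (cross (w 0) (w 2))^-1 *:
    \matrix_(i, j) (nth [::] [:: [:: w 2 0 1; - w 0 0 1];
                                 [:: - w 2 0 0; w 0 0 0]] i)`_j.
  have wM k : w k *m M = pt (cross (w k) (w 2) / cross (w 0) (w 2))
                            (cross (w 0) (w k) / cross (w 0) (w 2)).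
    by apply: rV2P; rewrite mulmx2 !mxE /= /cross; field; exact: D0.
  exists M, 0; split.
    rewrite unitmxE det2 !mxE /= unitfE.
    set D := cross _ _.
    rewrite (_ : _ - _ = D^-1); first by rewrite invr_eq0.
    by rewrite /D /cross; field.
  have cxx u : cross u u = 0 :> R by rewrite /cross mulrC subrr.
  have cC u v : cross u v = - cross v u :> R by rewrite /cross; ring.
  have half k : (k < 4)%N -> canonical (coords w) (inZp k) = w (inZp k) *m M.
    case: k => [|[|[|[|//]]]] _; rewrite wM /canonical /= ?mxE /=.
    - by rewrite (_ : inZp 0 = 0) ?cxx ?mul0r ?divff //; exact: val_inj.
    - by rewrite (_ : inZp 1 = 1) //; exact: val_inj.
    - by rewrite (_ : inZp 2 = 2) ?cxx ?mul0r ?divff //; exact: val_inj.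
    - rewrite (_ : inZp 3 = 3); last exact: val_inj.
      by rewrite [cross (w 3) _]cC mulNr.
  move=> k; rewrite addr0.
  have [k4|k4] := ltnP k 4.
    by have := half _ k4; rewrite valZpK.
  have k48 : (k - 4 < 4)%N by rewrite ltn_subLR // (ltn_ord k).
  have -> : k = inZp (k - 4) + 4 :> 'Z_8.
    apply: val_inj; rewrite /= (modn_small (ltn_trans k48 _)) // subnK //.
    by rewrite modn_small // (ltn_ord k).
  by rewrite canonical_sym half // sw mulNmx.
Qed.

Lemma line_meetN (R : realType) (p q r s : 'rV[R]_2) :
  line_meet (- p) (- q) (- r) (- s) = - line_meet p q r s.
Proof.
have cNN u v : cross (- u) (- v) = cross u v :> R.
  by rewrite /cross !mxE; ring.
by rewrite /line_meet /lines_cross -!opprD !cNN scalerN opprD.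
Qed.

Lemma diag3_sym (R : realType) (v : octagon R) :
  centrally_symmetric v -> centrally_symmetric (diag3 v).
Proof.
move=> sv k; rewrite /diag3 -line_meetN -!sv.
by rewrite [k + 4 + 1]addrAC [k + 4 + 2]addrAC [k + 4 + 5]addrAC.
Qed.

Lemma T3P (R : realType) (x y : 'rV[R]_4) : T3_defined x ->
  affine_equiv (diag3 (canonical x)) (canonical y) <-> y = T3 x.
Proof. by move=> [_ D0]; apply: coordsP => //; exact/diag3_sym/canonical_sym. Qed.

Definition mapA (R : realType) (x : 'rV[R]_4) : 'rV[R]_4 :=
  \row_j [:: - x 0 1; - x 0 0; - x 0 3; - x 0 2]`_j.

Definition mapDelta (R : realType) (x : 'rV[R]_4) : 'rV[R]_4 :=
  let a := x 0 0 in let b := x 0 1 in let c := x 0 2 in let d := x 0 3 in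
  let e := a * c + b * d in
  \row_j [:: b * (c + d + 1) / (c * (e + a + c + 1));
             d * (e + b + c) / (c * (e + a + c + 1));
             d * (a + b + 1) / (a * (e + a + c + 1));
             b * (e + a + d) / (a * (e + a + c + 1))]`_j.

Definition Delta_defined (R : realType) (x : 'rV[R]_4) :=
  let a := x 0 0 in let b := x 0 1 in let c := x 0 2 in let d := x 0 3 in
  [/\ a != 0, c != 0 & a * c + b * d + a + c + 1 != 0].

Lemma T3E (R : realType) (x : 'rV[R]_4) :
  T3_defined x -> Delta_defined x -> Delta_defined (mapA (mapDelta x)) ->
  T3 x = mapA (mapDelta (mapA (mapDelta x))).
Proof.
rewrite /T3_defined /Delta_defined /T3 /coords.
set a : R := x 0 0; set b : R := x 0 1; set c : R := x 0 2; set d : R := x 0 3.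
move=> [q D0] [a0 c0 m0].
have q1 : a + b + 1 != 0.
  rewrite (_ : _ + _ = lines_cross (canonical x (0 + 1)) (canonical x (0 + 4))
    (canonical x (0 + 2)) (canonical x (0 + 5))); first exact: q.
  rewrite /lines_cross /cross !mxE /= -?/a -?/b -?/c -?/d.
  ring.
have q2 : a * c + b * d + a + d != 0.
  rewrite (_ : _ + _ = lines_cross (canonical x (1 + 1)) (canonical x (1 + 4))
    (canonical x (1 + 2)) (canonical x (1 + 5))); first exact: q.
  rewrite /lines_cross /cross !mxE /= -?/a -?/b -?/c -?/d.
  ring.
have q3 : c + d + 1 != 0.
  rewrite (_ : _ + _ = lines_cross (canonical x (2 + 1)) (canonical x (2 + 4))
    (canonical x (2 + 2)) (canonical x (2 + 5))); first exact: q.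
  rewrite /lines_cross /cross !mxE /= -?/a -?/b -?/c -?/d.
  ring.
have q4 : a * c + b * d + b + c != 0.
  rewrite (_ : _ + _ = lines_cross (canonical x (3 + 1)) (canonical x (3 + 4))
    (canonical x (3 + 2)) (canonical x (3 + 5))); first exact: q.
  rewrite /lines_cross /cross !mxE /= -?/a -?/b -?/c -?/d.
  ring.
have w0 : diag3 (canonical x) 0 =
    pt (a - 2 * a * (1 + a) / (a + b + 1)) (b - 2 * a * b / (a + b + 1)).
  rewrite /diag3 /line_meet /lines_cross /cross.
  by apply: rV2P; rewrite !mxE /= -/a -/b; field.
have w1 : diag3 (canonical x) 1 =
    pt (- (2 * a * d) / (a * c + b * d + a + d))
       (1 - 2 * d * (b + 1) / (a * c + b * d + a + d)).
  rewrite /diag3 /line_meet /lines_cross /cross.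
  by apply: rV2P; rewrite !mxE /= -?/a -?/b -?/c -?/d; field.
have w2 : diag3 (canonical x) 2 =
    pt (- d + 2 * c * d / (c + d + 1)) (c - 2 * c * (1 + c) / (c + d + 1)).
  rewrite /diag3 /line_meet /lines_cross /cross.
  by apply: rV2P; rewrite !mxE /= -?/a -?/b -?/c -?/d; field.
have w3 : diag3 (canonical x) 3 =
    pt (- 1 + 2 * b * (d + 1) / (a * c + b * d + b + c))
       (- (2 * b * c) / (a * c + b * d + b + c)).
  rewrite /diag3 /line_meet /lines_cross /cross.
  by apply: rV2P; rewrite !mxE /= -?/a -?/b -?/c -?/d; field.
set D := cross (diag3 (canonical x) 0) (diag3 (canonical x) 2) in D0 *.
pose N := a * c * (b - a - 1) * (d - c - 1) - b * d * (b + 1 - a) * (c - d - 1).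
have DE : D = N / ((a + b + 1) * (c + d + 1)) 
  by rewrite /D w0 w2 /cross !mxE /= /N; field; rewrite q1 q3.
have N0 : N != 0 by apply: contraNneq D0 => N0; rewrite DE N0 mul0r.
have mE : let y := mapA (mapDelta x) in
    y 0 0 * y 0 2 + y 0 1 * y 0 3 + y 0 0 + y 0 2 + 1 =
    N / (a * c * (a * c + b * d + a + c + 1)).
  by rewrite /= !mxE /= -/a -/b -/c -/d /N; field; rewrite a0 c0 m0.
move=> [a1 c1 _].
have b0 : b != 0.
  by apply: contraNneq c1; rewrite !mxE /= -/b => ->; rewrite !mul0r oppr0.
have d0 : d != 0.
  by apply: contraNneq a1; rewrite !mxE /= -/d => ->; rewrite !mul0r oppr0.
rewrite DE w0 w1 w2 w3 /cross.
have [y yE] : exists y, y = mapA (mapDelta x) by eexists.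
rewrite -yE /= in mE *.
apply/rowP => -[[|[|[|[|//]]]] i]; rewrite !mxE /= mE yE !mxE /= -/a -/b -/c -/d;
  move: N0; generalize N => n n0; field;
  by rewrite ?q1 ?q2 ?q3 ?q4 ?a0 ?b0 ?c0 ?d0 ?m0 ?n0.
Qed.

(* Main.v *)
From HB Require Import structures.
Require Import Defs.
From mathcomp Require Import all_boot all_order all_algebra.
From mathcomp Require Import all_classical all_reals all_analysis.
From mathcomp Require Import ring lra.
From mathcomp Require Import -(notations) mpoly.

(** The symplectic form is [omega = da db / (a b) + dc dd / (c d)], which is
    log-canonical: it has constant coefficients in [log a, ..., log d].  It is
    therefore closed, and nondegenerate off the coordinate hyperplanes.

    The invariants come from the affine dependencies (indices mod 8)
      [al_k v_(k+1) - 2 y_k v_(k+2) + 2 z_k v_(k+4) - be_k v_(k+5) = 0]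
    between the end points of the two diagonals that meet in [v'_k].  For the
    canonical representative [(y_k, z_k)] is [(b, a), (a, d), (d, c), (c, b)]
    for [k = 0, ..., 3], and [al_k], [be_k] are the polynomials defined below.
    Split the relations into the difference operators [D+], carrying
    [v_(k+1)] and [v_(k+4)], and [D-], carrying [v_(k+2)] and [v_(k+5)].  Then
    [v' = D+ v = - D- v] up to rescaling, and the relations of the new octagon
    can be taken to be [D'+ + D'-] with [D'+ D- = D'- D+].  So the 3-diagonal
    map conjugates the Lax operator [(D-)^-1 D+].  The spectral determinant
    [det (D+ + w D-)], on sequences with [S_(k+4) = z S_k], is therefore conserved
    up to scale, and two ratios of its coefficients are
      [F1 = al_0 al_1 al_2 al_3 / (a b c d)],
      [F2 = be_0 be_1 be_2 be_3 / (a b c d)]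
    up to a constant.

    Invariance can be verified directly, because the 3-diagonal map
    factors well.  Every coordinate of [T3 x] is a quotient of products of the
    coordinates of [x], the determinants [q_k] and [frame] that have to be
    nonzero for [T3 x] to exist, and four cubics [num_k]; the [al_k] and [be_k]
    of [T3 x] factor in the same way ([factors_T3]).  The products that make up
    [F1] and [F2] then telescope.

    In the pullback of [omega] the logarithmic differential of each coordinate is
    a signed sum of logarithmic differentials of those factors.  The first two
    coordinates of [T3 x] are functions of the two quantities
    [2 a q2 / (al2 q1)] and [2 d q0 / (be0 q1)] alone, which makes the first
    summand of the pullback an explicit multiple of the wedge product of their
    logarithmic differentials ([log_diff_wedge]).  The same lemma applies to the
    last two coordinates, and the sum of the two results is [omega] ([omega_T3]).
    The bracket of [F1] and [F2] vanishes by direct differentiation.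

    Algebraic independence is visible on the plane [a = d = 1], where
    [F1 = 2 (2 - c) (b + c)] and [F2 = 2 (2 - b) (b + c)]: a quadratic equation
    for [b + c] shows that [(F1, F2)] takes all values in a square, and a
    polynomial vanishing on a square is zero. *)

Set Implicit Arguments.
Unset Strict Implicit.
Unset Printing Implicit Defensive.

Import Order.TTheory GRing.Theory Num.Theory.
Import numFieldNormedType.Exports.

Local Open Scope classical_set_scope.
Local Open Scope ring_scope.

(** * Differentials and logarithmic differentials *)

(** A plain proposition rather than a class, so that the syntax-directed rules
    below are applied without instance search. *)
Definition has_diff (R : realType) (V W : normedModType R) (x : V)
  (f df : V -> W) : Prop := is_diff x f df.

Lemma has_diff_derive (R : realType) (V W : normedModType R) (x : V)
  (f df : V -> W) u : has_diff x f df -> 'D_u f x = df u.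
Proof. by move=> [fd <-]; rewrite deriveE. Qed.

(** The difference of two functions that agree near [x] is differentiable with
    differential zero, because it vanishes near [x]. *)
Lemma has_diff_near (R : realType) (V W : normedModType R) (f g df : V -> W) x :
  (\near x, f x = g x) -> has_diff x f df -> has_diff x g df.
Proof.
move=> fg fdf.
have h0 : continuous (0 : V -> W) /\
    (g - f) \o shift x = cst ((g - f) x) + (0 : V -> W) +o_ 0 id.
  split; first by move=> ?; exact: cst_continuous.
  apply/eqaddoP => _/posnumP[e].
  have e0 : f x = g x := nbhs_singleton fg.
  move: fg; rewrite (near_shift 0 x) subr0 => fg; near=> y.
  have ey : f (y + x) = g (y + x) by near: y.
  by rewrite !fctE /= e0 ey !subrr !addr0 subrr normr0 mulr_ge0.
have hd : is_diff x (g - f) 0.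
  have h1 := diff_unique h0.1 h0.2.
  by apply: DiffDef; [apply/diff_locallyP; rewrite h1; exact: h0 | rewrite h1].
rewrite (_ : g = f + (g - f)); last by rewrite addrC subrK.
by have := is_diffD fdf hd; rewrite addr0.
Unshelve. all: by end_near. Qed.

Lemma has_diff_coord (R : realType) n (x : 'rV[R]_n) i :
  has_diff x (fun y : 'rV[R]_n => y 0 i) (fun u => u 0 i).
Proof.
have fl : linear (fun y : 'rV[R]_n => y 0 i : R) by move=> a u v; rewrite !mxE.
pose fM := GRing.isLinear.Build _ _ _ _ _ fl.
pose f : {linear 'rV[R]_n -> R} := HB.pack (fun y : 'rV[R]_n => y 0 i) fM.
apply: DiffDef; first exact: differentiable_coord.
exact: (@diff_lin _ _ _ f x (@coord_continuous _ _ _ 0 i)).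
Qed.

Lemma has_diff_const (R : realType) (V : normedModType R) (x : V) (c : R) :
  has_diff x (fun=> c) (fun=> 0).
Proof. exact: is_diff_cst. Qed.

Lemma has_diff_ext (R : realType) (V W : normedModType R) (f df dg : V -> W) x :
  has_diff x f df -> df =1 dg -> has_diff x f dg.
Proof. by move=> fd /funext <-. Qed.

Section Rules.
Variables (R : realType) (V : normedModType R) (x : V).
Implicit Types f g df dg : V -> R.

Lemma has_diff_add f g df dg : has_diff x f df -> has_diff x g dg ->
  has_diff x (fun y => f y + g y) (fun u => df u + dg u).
Proof. exact: is_diffD. Qed.

Lemma has_diff_opp f df : has_diff x f df ->
  has_diff x (fun y => - f y) (fun u => - df u).
Proof. exact: is_diffN. Qed.

Lemma has_diff_mul f g df dg : has_diff x f df -> has_diff x g dg ->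
  has_diff x (fun y => f y * g y) (fun u => f x * dg u + g x * df u).
Proof. exact: is_diffM. Qed.

Lemma has_diff_inv f df : f x != 0 -> has_diff x f df ->
  has_diff x (fun y => (f y)^-1) (fun u => - (f x) ^- 2 * df u).
Proof.
move=> fx0 [fd fE]; apply: DiffDef; first exact: differentiableV.
by rewrite diffV // fE.
Qed.

End Rules.

Lemma has_diff_row (R : realType) (V : normedModType R) n (x : V)
    (f : V -> 'rV[R]_n) (df : 'I_n -> V -> R) :
  (forall j, has_diff x (fun y => f y 0 j) (df j)) ->
  has_diff x f (fun u => \row_j df j u).
Proof.
move=> h.
have hs : is_diff x
    (\sum_(j < n) (fun y => f y 0 j *: (delta_mx 0 j : 'rV[R]_n)))
    (\sum_(j < n) (fun u => df j u *: (delta_mx 0 j : 'rV[R]_n))).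
  elim/big_ind2: _ => [|f1 df1 f2 df2 h1 h2|j _]; first exact: is_diff_cst.
    exact: is_diffD.
  have [fd fE] := h j; apply: DiffDef; first exact: differentiableZl.
  by rewrite diffZl // fE.
rewrite (_ : f = \sum_(j < n) (fun y => f y 0 j *: delta_mx 0 j)); last first.
  by apply/funext => y; rewrite fct_sumE {1}[f y]row_sum_delta.
rewrite (_ : (fun u => _) = \sum_(j < n) (fun u => df j u *: delta_mx 0 j)) //.
apply/funext => u; rewrite fct_sumE [LHS]row_sum_delta.
by apply: eq_bigr => j _; rewrite mxE.
Qed.

(** [l] is the logarithmic differential [df / f] at [x].  It turns products into
    sums, which keeps the differentials of factored functions small. *)
Definition log_diff (R : realType) (V : normedModType R) (x : V)
  (f l : V -> R) :=
  f x != 0 /\ has_diff x f (fun u => f x * l u).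

Section LogRules.
Variables (R : realType) (V : normedModType R) (x : V).
Implicit Types f g l k : V -> R.

Lemma log_diff_of_diff f df : f x != 0 -> has_diff x f df ->
  log_diff x f (fun u => df u / f x).
Proof.
move=> fx0 fd; split=> //.
by apply: has_diff_ext fd _ => u; rewrite mulrC divfK.
Qed.

Lemma log_diff_mul f g l k : log_diff x f l -> log_diff x g k ->
  log_diff x (fun y => f y * g y) (fun u => l u + k u).
Proof.
move=> [fx0 fd] [gx0 gd]; split; first by rewrite mulf_neq0.
by apply: has_diff_ext (has_diff_mul fd gd) _ => u; ring.
Qed.

Lemma log_diff_div f g l k : log_diff x f l -> log_diff x g k ->
  log_diff x (fun y => f y / g y) (fun u => l u - k u).
Proof.
move=> hf [gx0 gd]; apply: log_diff_mul => //; split; first by rewrite invr_eq0.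
by apply: has_diff_ext (has_diff_inv gx0 gd) _ => u; field.
Qed.

Lemma log_diff_near f g l : (\near x, f x = g x) -> log_diff x f l ->
  log_diff x g l.
Proof.
move=> fg [fx0 fd]; rewrite /log_diff -(nbhs_singleton fg); split=> //.
exact: has_diff_near fg fd.
Qed.

End LogRules.

(** The map [(l, m, k, al, be) -> (f, g)] below only depends on
    [P = l / (al k)] and [Q = m / (be k)]: with [p], [q] and [n] as below,
    [f = Q (P - 1) / (P + Q - 2)] and [g = P (Q - 1) / (P + Q - 2)].  A direct
    computation gives [dlog f dlog g = 2 / (P + Q - 2) dlog P dlog Q], and
    [P + Q - 2 = n / (al be k)].  Clearing [al] and [be], which may vanish, gives
    the form stated here. *)
Lemma log_diff_wedge (R : realType) (V : normedModType R) (x : V)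
    (l m k al be L M K dal dbe : V -> R)
    (p := fun y => l y - al y * k y) (q := fun y => m y - be y * k y)
    (n := fun y => al y * q y + be y * p y) :
  p x != 0 -> q x != 0 -> n x != 0 ->
  log_diff x l L -> log_diff x m M -> log_diff x k K ->
  has_diff x al dal -> has_diff x be dbe ->
  exists f g, [/\ log_diff x (fun y => m y * p y / (k y * n y)) f,
    log_diff x (fun y => l y * q y / (k y * n y)) g &
    forall u v, f u * g v - g u * f v = 2 * k x / n x *
      ((al x * (L u - K u) - dal u) * (be x * (M v - K v) - dbe v) -
       (al x * (L v - K v) - dal v) * (be x * (M u - K u) - dbe u))].
Proof.
move=> px qx nx hl hm hk hal hbe.
have hp : has_diff x p (fun u => l x * L u - (al x * (k x * K u) + k x * dal u)).
  apply: has_diff_add hl.2 _; apply/has_diff_opp/has_diff_mul => //.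
  exact: hk.2.
have hq : has_diff x q (fun u => m x * M u - (be x * (k x * K u) + k x * dbe u)).
  apply: has_diff_add hm.2 _; apply/has_diff_opp/has_diff_mul => //.
  exact: hk.2.
have hn := has_diff_add (has_diff_mul hal hq) (has_diff_mul hbe hp).
have lkn := log_diff_mul hk (log_diff_of_diff nx hn).
eexists; eexists; split.
- exact: log_diff_div (log_diff_mul hm (log_diff_of_diff px hp)) lkn.
- exact: log_diff_div (log_diff_mul hl (log_diff_of_diff qx hq)) lkn.
move=> u v /=; move: px qx nx; rewrite /n /p /q => px qx nx.
by field; rewrite px qx nx.
Qed.

Lemma near_neq0 (R : realType) (V : normedModType R) (x : V) (f df : V -> R) :
  has_diff x f df -> f x != 0 -> \near x, f x != 0.
Proof.
move=> [/differentiable_continuous fc _] fx0.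
by apply: (fc [set r | r != 0]); exact: open_nbhs_nbhs.
Qed.

Ltac poly_diff := repeat first
  [ exact: has_diff_coord | exact: has_diff_const | apply: has_diff_add
  | apply: has_diff_opp | apply: has_diff_mul ].

Ltac poly_diff_eq :=
  apply: has_diff_ext; [by poly_diff | by move=> ? /=; ring].

(** * Factors of the 3-diagonal map *)

Section Factors.
Variable R : realType.
Implicit Types x u v : 'rV[R]_4.

Definition esum x := x 0 0 * x 0 2 + x 0 1 * x 0 3.

(** [q_k] is the determinant of the directions of the diagonals
    [v_(k+1) v_(k+4)] and [v_(k+2) v_(k+5)]. *)
Definition q0 x := x 0 0 + x 0 1 + 1.
Definition q1 x := esum x + x 0 0 + x 0 3.
Definition q2 x := x 0 2 + x 0 3 + 1.
Definition q3 x := esum x + x 0 1 + x 0 2.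

(** [al_k] and [- be_k] are the coefficients of [v_(k+1)] and [v_(k+5)] in the
    affine dependency of [v_(k+1), v_(k+2), v_(k+4), v_(k+5)]. *)
Definition al0 x := 1 - x 0 0 + x 0 1.
Definition al1 x := esum x + x 0 0 - x 0 3.
Definition al2 x := 1 - x 0 2 + x 0 3.
Definition al3 x := esum x - x 0 1 + x 0 2.
Definition be0 x := 1 + x 0 0 - x 0 1.
Definition be1 x := esum x - x 0 0 + x 0 3.
Definition be2 x := 1 + x 0 2 - x 0 3.
Definition be3 x := esum x + x 0 1 - x 0 2.

(** [num_k] is what is left of the determinant of two vertices of the new octagon
    when the evident factors are taken out: [v'_1, v'_2] for [num0], [v'_0, v'_1]
    for [num1], [v'_0, v'_3] for [num2] and [v'_2, v'_3] for [num3]. *)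
Definition num0 x := 2 * x 0 0 * q2 x - al2 x * q1 x.
Definition num1 x := 2 * x 0 3 * q0 x - be0 x * q1 x.
Definition num2 x := 2 * x 0 2 * q0 x - al0 x * q3 x.
Definition num3 x := 2 * x 0 1 * q2 x - be2 x * q3 x.

(** The determinant of [v'_0] and [v'_2], up to [2 * q0 x * q2 x]: these vertices
    are the frame in which the coordinates of the new octagon are read off. *)
Definition frame x := al2 x * num1 x + be0 x * num0 x.

(** Shifting the labels by 2 exchanges [(a, b)] with [(c, d)], and the two
    expressions for [frame] with it.  With the second expression the last two
    coordinates of [T3 x] have the same shape as the first two. *)
Lemma frame_sym x : frame x = al0 x * num3 x + be2 x * num2 x.
Proof.
rewrite /frame /num0 /num1 /num2 /num3 /q0 /q1 /q2 /q3 /al0 /al2 /be0 /be2 /esum.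
ring.
Qed.

Definition T3_den x := q0 x * q1 x * q2 x * q3 x * frame x.

Lemma lines_crossE x :
  [/\ lines_cross (Defs.canonical x (0 + 1)) (Defs.canonical x (0 + 4))
        (Defs.canonical x (0 + 2)) (Defs.canonical x (0 + 5)) = q0 x,
      lines_cross (Defs.canonical x (1 + 1)) (Defs.canonical x (1 + 4))
        (Defs.canonical x (1 + 2)) (Defs.canonical x (1 + 5)) = q1 x,
      lines_cross (Defs.canonical x (2 + 1)) (Defs.canonical x (2 + 4))
        (Defs.canonical x (2 + 2)) (Defs.canonical x (2 + 5)) = q2 x
    & lines_cross (Defs.canonical x (3 + 1)) (Defs.canonical x (3 + 4))
        (Defs.canonical x (3 + 2)) (Defs.canonical x (3 + 5)) = q3 x].
Proof.
by split; rewrite /lines_cross /cross !mxE /= /q0 /q1 /q2 /q3 /esum; ring.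
Qed.

Lemma diag3E x : q0 x * q1 x * q2 x * q3 x != 0 ->
  [/\ diag3 (Defs.canonical x) 0 =
        (q0 x)^-1 *: pt (- (x 0 0 * be0 x)) (x 0 1 * al0 x),
      diag3 (Defs.canonical x) 1 =
        (q1 x)^-1 *: pt (- (2 * x 0 0 * x 0 3)) (q1 x - 2 * x 0 3 * (1 + x 0 1)),
      diag3 (Defs.canonical x) 2 =
        (q2 x)^-1 *: pt (- (x 0 3 * al2 x)) (- (x 0 2 * be2 x))
    & diag3 (Defs.canonical x) 3 =
        (q3 x)^-1 *: pt (2 * x 0 1 * (1 + x 0 3) - q3 x) (- (2 * x 0 1 * x 0 2))].
Proof.
rewrite !mulf_eq0 !negb_or -!andbA => /and4P[q0x q1x q2x q3x].
have [h1 h2 h3 h4] := lines_crossE x.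
split; rewrite /diag3 /line_meet ?h1 ?h2 ?h3 ?h4;
  apply: rV2P; rewrite /cross !mxE /=;
  [move: q0x|move: q0x|move: q1x|move: q1x
  |move: q2x|move: q2x|move: q3x|move: q3x];
  rewrite /q0 /q1 /q2 /q3 /be0 /al0 /al2 /be2 /esum => q; field; exact: q.
Qed.

Lemma cross_diag3 x : q0 x * q1 x * q2 x * q3 x != 0 ->
  cross (diag3 (Defs.canonical x) 0) (diag3 (Defs.canonical x) 2) =
  frame x / (2 * q0 x * q2 x).
Proof.
move=> qx; have [-> _ -> _] := diag3E qx.
move: qx; rewrite !mulf_eq0 !negb_or -!andbA => /and4P[q0x q1x q2x q3x].
rewrite /cross !mxE /= /frame /num0 /num1 /q1 /esum /al0 /al2 /be0 /be2.
move: q0x q2x; rewrite /q0 /q2 => q0x q2x.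
by field; rewrite q0x q2x.
Qed.

Lemma T3_defined_den x : T3_defined x -> T3_den x != 0.
Proof.
move=> [q D0]; have [h1 h2 h3 h4] := lines_crossE x.
have qx : q0 x * q1 x * q2 x * q3 x != 0.
  by rewrite -h1 -h2 -h3 -h4 !mulf_neq0.
rewrite mulf_neq0 //; apply: contraNneq D0 => nx.
by rewrite cross_diag3 // nx mul0r.
Qed.

Definition T3_coord x (j : 'I_4) : R :=
  [:: 2 * x 0 3 * q0 x * num0 x / (q1 x * frame x);
      2 * x 0 0 * q2 x * num1 x / (q1 x * frame x);
      2 * x 0 1 * q2 x * num2 x / (q3 x * frame x);
      2 * x 0 2 * q0 x * num3 x / (q3 x * frame x)]`_j.

Lemma T3_formula x : T3_den x != 0 -> T3 x = \row_j T3_coord x j.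
Proof.
rewrite /T3_den mulf_eq0 negb_or => /andP[qx nx].
rewrite /T3 /coords cross_diag3 //; have [-> -> -> ->] := diag3E qx.
move: qx; rewrite !mulf_eq0 !negb_or -!andbA => /and4P[q0x q1x q2x q3x].
apply/rowP => -[[|[|[|[|//]]]] i];
  rewrite !mxE /T3_coord /= /cross !mxE /=;
  move: nx; generalize (frame x) => n nx;
  move: q0x q1x q2x q3x;
  rewrite /num0 /num1 /num2 /num3 /q0 /q1 /q2 /q3 /al0 /al2 /be0 /be2 /esum
    => q0x q1x q2x q3x;
  field; rewrite ?q0x ?q1x ?q2x ?q3x ?nx //.
Qed.

Lemma T3_den_factors_neq0 x : T3_den x != 0 ->
  [/\ q0 x != 0, q1 x != 0, q2 x != 0, q3 x != 0 & frame x != 0].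
Proof. by rewrite /T3_den !mulf_eq0 !negb_or -!andbA => /and5P. Qed.

Lemma T3_num_neq0 x : T3_den x != 0 -> (forall i, T3 x 0 i != 0) ->
  [/\ num0 x != 0, num1 x != 0, num2 x != 0 & num3 x != 0].
Proof.
move=> dx; rewrite T3_formula // => y0.
have := y0 0; have := y0 1; have := y0 2; have := y0 3.
rewrite !mxE /T3_coord /= !mulf_eq0 !negb_or -!andbA.
by move=> /and5P[_ _ _ -> _] /and5P[_ _ _ -> _] /and5P[_ _ _ -> _] /and5P[_ _ _ -> _].
Qed.

(** [T3] agrees with [T3_formula] in a neighbourhood of each point where it is
    defined, so that it can be differentiated through the formula. *)
Lemma T3_den_near x : T3_defined x -> \near x, T3_den x != 0.
Proof.
move=> /T3_defined_den; apply: near_neq0.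
rewrite /T3_den /frame /num0 /num1 /q0 /q1 /q2 /q3 /al2 /be0 /esum.
poly_diff.
Qed.

(** The same factors as in [T3_coord] appear here.  In the product over [k] each
    [num_k] occurs exactly once, as it does in the product of the coordinates of
    [T3 x]. *)
Lemma factors_T3 x : T3_den x != 0 ->
  [/\ al0 (T3 x) = 2 * al2 x * num1 x / frame x,
      al1 (T3 x) = 2 * q0 x * q2 x * al3 x * num0 x / (q1 x * q3 x * frame x),
      al2 (T3 x) = 2 * al0 x * num3 x / frame x &
      al3 (T3 x) = 2 * q0 x * q2 x * al1 x * num2 x / (q1 x * q3 x * frame x)] /\
  [/\ be0 (T3 x) = 2 * be0 x * num0 x / frame x,
      be1 (T3 x) = 2 * q0 x * q2 x * be1 x * num3 x / (q1 x * q3 x * frame x),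
      be2 (T3 x) = 2 * be2 x * num2 x / frame x &
      be3 (T3 x) = 2 * q0 x * q2 x * be3 x * num1 x / (q1 x * q3 x * frame x)].
Proof.
move=> dx; have [q0x q1x q2x q3x nx] := T3_den_factors_neq0 dx.
rewrite T3_formula //.
split; split;
  rewrite /al0 /al1 /al2 /al3 /be0 /be1 /be2 /be3 /esum !mxE /T3_coord /=;
  move: q0x q1x q2x q3x nx;
  rewrite /frame /num0 /num1 /num2 /num3 /q0 /q1 /q2 /q3 /al0 /al2 /be0 /be2
    /esum => q0x q1x q2x q3x nx;
  field; rewrite ?q0x ?q1x ?q2x ?q3x ?nx //.
Qed.

End Factors.

(** * The symplectic form and the invariants as rational functions *)

Section Forms.
Variable R : realType.
Implicit Types x u v w : 'rV[R]_4.

Lemma sum_ord4 (V : nmodType) (F : 'I_4 -> V) :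
  \sum_i F i = F 0 + F 1 + F 2 + F 3.
Proof.
rewrite !big_ord_recl big_ord0 addr0 !addrA.
by congr (F _ + F _ + F _ + F _); exact: val_inj.
Qed.

Lemma forall_ord4 (P : 'I_4 -> Prop) :
  P 0 -> P 1 -> P 2 -> P 3 -> forall i, P i.
Proof.
move=> P0 P1 P2 P3 [[|[|[|[|//]]]] i].
- by rewrite (_ : Ordinal i = 0) //; exact: val_inj.
- by rewrite (_ : Ordinal i = 1) //; exact: val_inj.
- by rewrite (_ : Ordinal i = 2) //; exact: val_inj.
- by rewrite (_ : Ordinal i = 3) //; exact: val_inj.
Qed.

Definition var (i : 'I_4) : mpoly 4 R := mpolyX R (mnm1 i).

Lemma pval_var i x : pval (var i) x = x 0 i.
Proof. exact: mevalXU. Qed.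

Lemma pvalD (p q : mpoly 4 R) x : pval (p + q) x = pval p x + pval q x.
Proof. exact: mevalD. Qed.
Lemma pvalN (p : mpoly 4 R) x : pval (- p) x = - pval p x.
Proof. exact: mevalN. Qed.
Lemma pvalM (p q : mpoly 4 R) x : pval (p * q) x = pval p x * pval q x.
Proof. exact: mevalM. Qed.
Lemma pval1 x : pval (1 : mpoly 4 R) x = 1.
Proof. exact: meval1. Qed.
Lemma pval0 x : pval (0 : mpoly 4 R) x = 0.
Proof. exact: meval0. Qed.

Definition pvalE := (pval0, pvalD, pvalN, pvalM, pval1, pval_var).

Lemma mpoly_neq0 n (p : mpoly n R) (x : 'rV[R]_n) : pval p x != 0 -> p != 0.
Proof. by apply: contraNneq => ->; rewrite /pval meval0. Qed.

Lemma varM_neq0 i j : var i * var j != 0.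
Proof.
apply: (@mpoly_neq0 _ _ (const_mx 1)).
by rewrite !pvalE !mxE mulf_neq0 ?oner_neq0.
Qed.

(** Every entry has denominator [x_i x_j], including the zero entries, so that
    [omega] is defined exactly off the coordinate hyperplanes. *)
Definition omega : form2 R 4 := fun i j =>
  RatFun (((i, j) \in [:: (0, 1); (2, 3)])%:R) (varM_neq0 i j).

Lemma fval_omega x u v : fval omega x u v =
  (u 0 0 * v 0 1 - u 0 1 * v 0 0) / (x 0 0 * x 0 1) +
  (u 0 2 * v 0 3 - u 0 3 * v 0 2) / (x 0 2 * x 0 3).
Proof.
rewrite /fval; under eq_bigr do rewrite big_mkcond sum_ord4 /=.
rewrite !sum_ord4 /= /ratval /= !pvalE !mul0r !addr0 !add0r !mul1r.
by congr (_ + _); rewrite mulrC.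
Qed.

Lemma fdefined_omega x : fdefined omega x <-> forall i, x 0 i != 0.
Proof.
split=> [h|h i j _]; last by rewrite /rdefined /= !pvalE mulf_neq0.
have := h 0 1 isT; have := h 2 3 isT.
rewrite /rdefined /= !pvalE !mulf_eq0 !negb_or.
by move=> /andP[x2 x3] /andP[x0 x1]; exact: forall_ord4.
Qed.

Lemma varM4_neq0 : var 0 * var 1 * (var 2 * var 3) != 0.
Proof.
apply: (@mpoly_neq0 _ _ (const_mx 1)).
by rewrite !pvalE !mxE !mulf_neq0 ?oner_neq0.
Qed.

Definition over_coords (p : mpoly 4 R) : ratfun R 4 := RatFun p varM4_neq0.

Lemma rdefined_over_coords p x :
  rdefined (over_coords p) x <-> forall i, x 0 i != 0.
Proof.
rewrite /rdefined /= !pvalE !mulf_eq0 !negb_or -!andbA.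
by split=> [/and4P[]|x0]; [exact: forall_ord4 | rewrite !x0].
Qed.

Definition esum_poly : mpoly 4 R := var 0 * var 2 + var 1 * var 3.

Definition inv1 : ratfun R 4 := over_coords
  ((1 - var 0 + var 1) * (esum_poly + var 0 - var 3) *
   (1 - var 2 + var 3) * (esum_poly - var 1 + var 2)).

Definition inv2 : ratfun R 4 := over_coords
  ((1 + var 0 - var 1) * (esum_poly - var 0 + var 3) *
   (1 + var 2 - var 3) * (esum_poly + var 1 - var 2)).

Lemma ratval_inv1 : ratval inv1 = fun x => al0 x * al1 x * al2 x * al3 x /
  (x 0 0 * x 0 1 * (x 0 2 * x 0 3)).
Proof. by apply/funext => x; rewrite /ratval /= !pvalE. Qed.

Lemma ratval_inv2 : ratval inv2 = fun x => be0 x * be1 x * be2 x * be3 x /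
  (x 0 0 * x 0 1 * (x 0 2 * x 0 3)).
Proof. by apply/funext => x; rewrite /ratval /= !pvalE. Qed.

End Forms.

(** * The form is symplectic *)

Section Properties.
Variable R : realType.
Implicit Types x u v w : 'rV[R]_4.

Lemma omega_closed : form_closed (@omega R).
Proof.
move=> x /fdefined_omega x0 u v w.
(* the differential of [1 / (x_i x_j)] is
   [- (dx_i / x_i + dx_j / x_j) / (x_i x_j)] *)
have d (s t : 'rV[R]_4) : has_diff x (fun y => fval (@omega R) y s t) (fun r =>
    - ((s 0 0 * t 0 1 - s 0 1 * t 0 0) *
       (r 0 0 / x 0 0 + r 0 1 / x 0 1) / (x 0 0 * x 0 1))
    - (s 0 2 * t 0 3 - s 0 3 * t 0 2) *
      (r 0 2 / x 0 2 + r 0 3 / x 0 3) / (x 0 2 * x 0 3)).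
  rewrite (funext (fun y => fval_omega y s t)); apply: has_diff_ext.
    apply: has_diff_add; apply: has_diff_mul; try exact: has_diff_const;
    by (apply: has_diff_inv; [rewrite mulf_neq0|poly_diff]).
  by move=> r; field; rewrite !x0.
by rewrite /ext_deriv !(has_diff_derive _ (d _ _)); field; rewrite !x0.
Qed.

(** Contracting [u] with a basis vector returns, up to a nonzero factor and a
    sign, the coordinate of [u] that is conjugate to it. *)
Lemma omega_nondegenerate x :
  fdefined (@omega R) x -> nondegenerate_at (@omega R) x.
Proof.
move=> /fdefined_omega x0 u hu.
have hd i j : fval (@omega R) x u (delta_mx 0 i) * (x 0 j * x 0 i) = 0.
  by rewrite hu mul0r.
apply/rowP; apply: forall_ord4; rewrite [RHS]mxE.
- by rewrite -(hd 1 0) fval_omega !mxE /=; field; rewrite !x0.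
- by apply/oppr_inj; rewrite oppr0 -(hd 0 1) fval_omega !mxE /=; field; rewrite !x0.
- by rewrite -(hd 3 2) fval_omega !mxE /=; field; rewrite !x0.
- by apply/oppr_inj; rewrite oppr0 -(hd 2 3) fval_omega !mxE /=; field; rewrite !x0.
Qed.

(** Density: a point of the hyperplane leaves it when it is moved in the [i]-th
    direction. *)
Lemma coord_neq0_open_dense n (i : 'I_n) :
  open [set x : 'rV[R]_n | x 0 i != 0] /\ dense [set x : 'rV[R]_n | x 0 i != 0].
Proof.
split.
  have /continuousP h : continuous (fun x : 'rV[R]_n => x 0 i).
    exact: coord_continuous.
  exact: (h [set r : R | r != 0] (open_neq (y := 0))).
move=> O [x Ox] oO; have [xi0|xi0] := eqVneq (x 0 i) 0; last by exists x.
pose g (t : R) : 'rV[R]_n := x + t *: delta_mx 0 i.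
have gc : {for 0, continuous g}.
  by apply: cvgD; [exact: cvg_cst | apply: cvgZr_tmp; exact: cvg_id].
have : \forall t \near (0 : R), O (g t).
  by apply: gc; apply: open_nbhs_nbhs; split => //; rewrite /g scale0r addr0.
move=> /nbhs_ballP[e e0 eO]; exists (g (e / 2)); split.
  apply: eO; rewrite /ball /= sub0r normrN gtr0_norm ?divr_gt0 //.
  by rewrite ltr_pdivrMr // ltr_pMr // ltr1n.
by rewrite /= /g !mxE xi0 add0r !eqxx mulr1 lt0r_neq0 ?divr_gt0.
Qed.

Lemma omega_symplectic : singular_symplectic (@omega R).
Proof.
split; first exact: omega_closed.
have [U0 d0] := coord_neq0_open_dense (0 : 'I_4).
have [U1 d1] := coord_neq0_open_dense (1 : 'I_4).
have [U2 d2] := coord_neq0_open_dense (2 : 'I_4).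
have [U3 d3] := coord_neq0_open_dense (3 : 'I_4).
exists ([set x | x 0 0 != 0] `&` ([set x | x 0 1 != 0] `&`
  ([set x | x 0 2 != 0] `&` [set x | x 0 3 != 0]))); split.
- by do 3 apply: openI => //.
- by do 3 apply: denseI => //.
move=> x /= [x0 [x1 [x2 x3]]].
have xd : fdefined (@omega R) x by apply/fdefined_omega; exact: forall_ord4.
by split => //; exact: omega_nondegenerate.
Qed.

(** * Invariance under the 3-diagonal map *)

Lemma inv1_T3 : fun_invariant (@inv1 R).
Proof.
move=> x /T3_defined_den dx /rdefined_over_coords x0 /rdefined_over_coords y0.
have [n0x n1x n2x n3x] := T3_num_neq0 dx y0.
have [q0x q1x q2x q3x nx] := T3_den_factors_neq0 dx.
have [[a0 a1 a2 a3] _] := factors_T3 dx.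
rewrite !ratval_inv1 a0 a1 a2 a3 T3_formula // !mxE /T3_coord /=; field.
by rewrite !x0 q0x q1x q2x q3x nx n0x n1x n2x n3x.
Qed.

Lemma inv2_T3 : fun_invariant (@inv2 R).
Proof.
move=> x /T3_defined_den dx /rdefined_over_coords x0 /rdefined_over_coords y0.
have [n0x n1x n2x n3x] := T3_num_neq0 dx y0.
have [q0x q1x q2x q3x nx] := T3_den_factors_neq0 dx.
have [_ [a0 a1 a2 a3]] := factors_T3 dx.
rewrite !ratval_inv2 a0 a1 a2 a3 T3_formula // !mxE /T3_coord /=; field.
by rewrite !x0 q0x q1x q2x q3x nx n0x n1x n2x n3x.
Qed.

(** The pullback of [omega] by [f] only involves the logarithmic differentials of
    the components of [f]. *)
Lemma fval_omega_log (f : 'rV[R]_4 -> 'rV[R]_4) x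
    (l0 l1 l2 l3 : 'rV[R]_4 -> R) u v :
  log_diff x (fun y => f y 0 0) l0 -> log_diff x (fun y => f y 0 1) l1 ->
  log_diff x (fun y => f y 0 2) l2 -> log_diff x (fun y => f y 0 3) l3 ->
  fval (@omega R) (f x) ('d f x u) ('d f x v) =
  l0 u * l1 v - l1 u * l0 v + (l2 u * l3 v - l3 u * l2 v).
Proof.
move=> [f0 d0] [f1 d1] [f2 d2] [f3 d3].
have fd : has_diff x f
    (fun u => \row_j (f x 0 j * nth l0 [:: l0; l1; l2; l3] j u)).
  by apply: has_diff_row; exact: forall_ord4.
rewrite (@diff_val _ _ _ _ _ _ _ fd) fval_omega !mxE /=; field.
by rewrite f0 f1 f2 f3.
Qed.

Lemma omega_T3 : form_invariant (@omega R).
Proof.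
move=> x dx /fdefined_omega x0 /fdefined_omega y0 u v.
have nx := T3_den_near dx.
have {}dx := T3_defined_den dx.
have [n0x n1x n2x n3x] := T3_num_neq0 dx y0.
have [q0x q1x q2x q3x dn] := T3_den_factors_neq0 dx.
have T3j j g l : (forall y, T3_coord y j = g y) -> log_diff x g l ->
    log_diff x (fun y => T3 y 0 j) l.
  move=> gE; apply: log_diff_near; apply: filterS nx => y dy.
  by rewrite T3_formula // mxE gE.
have coordE i (g Q : 'rV[R]_4 -> R) : log_diff x g Q ->
    log_diff x (fun y => 2 * y 0 i * g y) (fun u => u 0 i / x 0 i + Q u).
  move=> gQ; apply: log_diff_mul gQ; split; first by rewrite mulf_neq0 ?pnatr_eq0.
  apply: has_diff_ext.
    by apply: has_diff_mul; [exact: has_diff_const | exact: has_diff_coord].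
  by move=> w; field; exact: x0.
pose de (w : 'rV[R]_4) :=
  w 0 0 * x 0 2 + x 0 0 * w 0 2 + w 0 1 * x 0 3 + x 0 1 * w 0 3.
have hq0 : log_diff x (@q0 R) (fun w => (w 0 0 + w 0 1) / q0 x).
  by apply: log_diff_of_diff => //; rewrite /q0; poly_diff_eq.
have hq1 : log_diff x (@q1 R) (fun w => (de w + w 0 0 + w 0 3) / q1 x).
  by apply: log_diff_of_diff => //; rewrite /q1 /esum /de; poly_diff_eq.
have hq2 : log_diff x (@q2 R) (fun w => (w 0 2 + w 0 3) / q2 x).
  by apply: log_diff_of_diff => //; rewrite /q2; poly_diff_eq.
have hq3 : log_diff x (@q3 R) (fun w => (de w + w 0 1 + w 0 2) / q3 x).
  by apply: log_diff_of_diff => //; rewrite /q3 /esum /de; poly_diff_eq.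
have hal0 : has_diff x (@al0 R) (fun w => w 0 1 - w 0 0).
  by rewrite /al0; poly_diff_eq.
have hal2 : has_diff x (@al2 R) (fun w => w 0 3 - w 0 2).
  by rewrite /al2; poly_diff_eq.
have hbe0 : has_diff x (@be0 R) (fun w => w 0 0 - w 0 1).
  by rewrite /be0; poly_diff_eq.
have hbe2 : has_diff x (@be2 R) (fun w => w 0 2 - w 0 3).
  by rewrite /be2; poly_diff_eq.
have [f0 [f1 [h0 h1 w01]]] := log_diff_wedge
  (l := fun y : 'rV[R]_4 => 2 * y 0 0 * q2 y)
  (m := fun y : 'rV[R]_4 => 2 * y 0 3 * q0 y)
  (k := @q1 R) (al := @al2 R) (be := @be0 R) n0x n1x dn
  (coordE 0 _ _ hq2) (coordE 3 _ _ hq0) hq1 hal2 hbe0.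
have dn' : al0 x * num3 x + be2 x * num2 x != 0 by rewrite -frame_sym.
have [f2 [f3 [h2 h3 w23]]] := log_diff_wedge
  (l := fun y : 'rV[R]_4 => 2 * y 0 2 * q0 y)
  (m := fun y : 'rV[R]_4 => 2 * y 0 1 * q2 y)
  (k := @q3 R) (al := @al0 R) (be := @be2 R) n2x n3x dn'
  (coordE 2 _ _ hq0) (coordE 1 _ _ hq2) hq3 hal0 hbe2.
have e2 (y : 'rV[R]_4) : T3_coord y 2 =
    2 * y 0 1 * q2 y * num2 y / (q3 y * (al0 y * num3 y + be2 y * num2 y)).
  by rewrite -frame_sym.
have e3 (y : 'rV[R]_4) : T3_coord y 3 =
    2 * y 0 2 * q0 y * num3 y / (q3 y * (al0 y * num3 y + be2 y * num2 y)).
  by rewrite -frame_sym.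
rewrite (fval_omega_log u v
  (T3j 0 _ _ (fun=> erefl) h0) (T3j 1 _ _ (fun=> erefl) h1)
  (T3j 2 _ _ e2 h2) (T3j 3 _ _ e3 h3)) w01 w23.
have := frame_sym x; rewrite /num2 /num3 => <-.
rewrite -/(num0 x) -/(num1 x) -/(frame x).
rewrite fval_omega /de; move: (x0 0) (x0 1) (x0 2) (x0 3) q0x q1x q2x q3x dn.
rewrite /frame /num0 /num1 /q0 /q1 /q2 /q3 /al0 /al2 /be0 /be2 /esum.
by move=> *; field; do ?(apply/andP; split).
Qed.

(** * The invariants commute *)

(** The Poisson bracket of [omega] at [x], for functions given by their
    differentials. *)
Definition bracket x (f g : 'rV[R]_4 -> R) : R :=
  let d (h : 'rV[R]_4 -> R) i := h (delta_mx 0 i) in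
  x 0 0 * x 0 1 * (d f 0 * d g 1 - d f 1 * d g 0) +
  x 0 2 * x 0 3 * (d f 2 * d g 3 - d f 3 * d g 2).

(** Hence [omega] of two Hamiltonian vectors is the bracket of the two functions:
    their contractions with [omega] are the differentials. *)
Lemma fval_omega_bracket x u v : (forall i, x 0 i != 0) ->
  fval (@omega R) x u v = bracket x (fval (@omega R) x u) (fval (@omega R) x v).
Proof.
by move=> x0; rewrite /bracket !fval_omega !mxE /=; field; rewrite !x0.
Qed.

Lemma inv_bracket x : (forall i, x 0 i != 0) ->
  exists df1 df2, [/\ has_diff x (ratval (@inv1 R)) df1,
    has_diff x (ratval (@inv2 R)) df2 & bracket x df1 df2 = 0].
Proof.
move=> x0; eexists; eexists; split.
- rewrite ratval_inv1 /al0 /al1 /al2 /al3 /esum; apply: has_diff_mul.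
    poly_diff.
  by apply: has_diff_inv; [rewrite !mulf_neq0 | poly_diff].
- rewrite ratval_inv2 /be0 /be1 /be2 /be3 /esum; apply: has_diff_mul.
    poly_diff.
  by apply: has_diff_inv; [rewrite !mulf_neq0 | poly_diff].
by rewrite /bracket !mxE /=; field; rewrite !x0.
Qed.

Lemma inv_commute : poisson_commute (@omega R) (@inv1 R) (@inv2 R).
Proof.
move=> X1 X2 h1 h2 x rx d1 d2.
have /fdefined_omega x0 := rx.1.
have [df1 [df2 [hd1 hd2 b0]]] := inv_bracket x0.
rewrite fval_omega_bracket // /bracket !h1 // !h2 //.
by rewrite !(has_diff_derive _ hd1) !(has_diff_derive _ hd2).
Qed.

(** * The invariants are algebraically independent *)

Lemma poly_eq0_of_roots (a : nat -> R) (p : {poly R}) : injective a ->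
  (forall i, p.[a i] = 0) -> p = 0.
Proof.
move=> a_inj pa; apply: (@roots_geq_poly_eq0 _ _ [seq a i | i <- iota 0 (size p)]).
- by apply/allP => _ /mapP[i _ ->]; rewrite rootE pa.
- by rewrite map_inj_uniq // iota_uniq.
- by rewrite size_map size_iota.
Qed.

(** A one-variable argument applied twice: for fixed [t = a j] all coefficients
    of [P(X, t)] vanish, and each of them is a polynomial in [t]. *)
Lemma mpoly2_eq0_of_grid (a : nat -> R) (P : mpoly 2 R) : injective a ->
  (forall i j, pval P (pt (a i) (a j)) = 0) -> P = 0.
Proof.
move=> a_inj Pa.
have PE s t : pval P (pt s t) =
    \sum_(m <- msupp P) mcoeff m P * (s ^+ m 0 * t ^+ m 1).
  rewrite /pval mevalE; apply: eq_bigr => m _; congr (_ * _).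
  rewrite !big_ord_recl big_ord0 mulr1 !mxE /=.
  by congr (_ ^+ m _ * _ ^+ m _); exact: val_inj.
have P1 j k : \sum_(m <- msupp P) mcoeff m P * a j ^+ m 1 * (k == m 0)%:R = 0.
  pose p := \sum_(m <- msupp P) (mcoeff m P * a j ^+ m 1) *: 'X^(m 0).
  have p0 : p = 0.
    apply: (poly_eq0_of_roots a_inj) => i; rewrite -(Pa i j) PE horner_sum.
    by apply: eq_bigr => m _; rewrite hornerZ hornerXn; ring.
  rewrite -[RHS](coef0 _ k) -p0 coef_sum.
  by apply: eq_bigr => m _; rewrite coefZ coefXn.
have P2 k l : \sum_(m <- msupp P) mcoeff m P * (k == m 0)%:R * (l == m 1)%:R = 0.
  pose p := \sum_(m <- msupp P) (mcoeff m P * (k == m 0)%:R) *: 'X^(m 1).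
  have p0 : p = 0.
    apply: (poly_eq0_of_roots a_inj) => j; rewrite -(P1 j k) horner_sum.
    by apply: eq_bigr => m _; rewrite hornerZ hornerXn; ring.
  rewrite -[RHS](coef0 _ l) -p0 coef_sum.
  by apply: eq_bigr => m _; rewrite coefZ coefXn.
apply/mpolyP => m; rewrite mcoeff0.
have [mP|/memN_msupp_eq0 //] := boolP (m \in msupp P).
have := P2 (m 0) (m 1); rewrite (bigD1_seq m) ?msupp_uniq //= !eqxx !mulr1.
rewrite big1 ?addr0 // => m' m'm.
case: eqVneq => [e0|_]; last by rewrite mulr0 mul0r.
case: eqVneq => [e1|_]; last by rewrite mulr0.
case/eqP: m'm; apply/mnmP => -[[|[|//]] i2].
- by rewrite (_ : Ordinal i2 = 0) //; exact: val_inj.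
- by rewrite (_ : Ordinal i2 = 1) //; exact: val_inj.
Qed.

Lemma inv_independent : alg_independent2 (@inv1 R) (@inv2 R).
Proof.
move=> P hP.
(* any infinite set of values in ]0, 1] would do *)
apply: (@mpoly2_eq0_of_grid (fun i => (i.+1)%:R^-1)) => [i j /invr_inj/eqP|i j].
  by rewrite eqr_nat => /eqP[].
set s := _^-1; set t := _^-1.
have s01 : 0 < s <= 1.
  by rewrite invr_gt0 ltr0Sn invf_le1 ?ltr0Sn // ler1n.
have t01 : 0 < t <= 1.
  by rewrite invr_gt0 ltr0Sn invf_le1 ?ltr0Sn // ler1n.
(* on the plane [a = d = 1] the values [s, t] determine [b] and [c] in terms of
   [p = b + c], and the sum of the two equations is
   [p ^ 2 - 4 p + (s + t) / 2 = 0] *)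
pose p := 2 + Num.sqrt (4 - (s + t) / 2).
have r0 : 0 <= 4 - (s + t) / 2 by lra.
have p2 : 2 <= p by rewrite lerDl sqrtr_ge0.
have pE : p ^+ 2 - 4 * p + (s + t) / 2 = 0.
  by rewrite /p sqrrD sqr_sqrtr //; field.
pose b := 2 - t / (2 * p); pose c := 2 - s / (2 * p).
have [b0 c0] : 0 < b /\ 0 < c.
  by split; rewrite subr_gt0 ltr_pdivrMr; nra.
have p0 : p != 0 by rewrite lt0r_neq0 //; lra.
have bc : b + c = p.
  apply: (@mulfI _ (2 * p)); first by rewrite mulf_neq0 // lt0r_neq0 //; lra.
  transitivity (8 * p - s - t); first by rewrite /b /c; field.
  lra.
pose x : 'rV[R]_4 := \row_j [:: 1; b; c; 1]`_j.
have x0 : forall k, x 0 k != 0.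
  by apply: forall_ord4; rewrite !mxE /= ?oner_neq0 ?lt0r_neq0.
have := hP x ((rdefined_over_coords _ x).2 x0) ((rdefined_over_coords _ x).2 x0).
have -> : ratval (@inv1 R) x = s.
  have -> : s = 2 * p * (2 - c) by rewrite /c; field.
  rewrite ratval_inv1 /al0 /al1 /al2 /al3 /esum !mxE /= -bc; field.
  by rewrite !lt0r_neq0.
have -> : ratval (@inv2 R) x = t.
  have -> : t = 2 * p * (2 - b) by rewrite /b; field.
  rewrite ratval_inv2 /be0 /be1 /be2 /be3 /esum !mxE /= -bc; field.
  by rewrite !lt0r_neq0.
by [].
Qed.

End Properties.

Theorem theorem1p4 (R : realType) :
  exists (omega : form2 R 4) (F1 F2 : ratfun R 4),
    singular_symplectic omega /\
    alg_independent2 F1 F2 /\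
    form_invariant omega /\
    fun_invariant F1 /\ fun_invariant F2 /\
    poisson_commute omega F1 F2.
Proof.
exists (@omega R), (@inv1 R), (@inv2 R).
split; first exact: omega_symplectic.
split; first exact: inv_independent.
split; first exact: omega_T3.
by split; [exact: inv1_T3 | split; [exact: inv2_T3 | exact: inv_commute]].
Qed.
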